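(* Let $L$ be a loop. Then $L$ is a diassociative A-loop if and only if $L$ is a Moufang loop and $L/\mathrm{Nuc}(L)$ is a commutative loop of exponent three.
   Context: A loop $(L,\cdot)$ is a nonempty set $L$ with a binary operation $\cdot$ (usually written as juxtaposition) such that (i) for all $a,b\in L$ the equations $ax=b$ and $ya=b$ each have unique solutions $x,y\in L$, and (ii) there is an identity element $1\in L$ with $1x=x1=x$ for all $x\in L$. For $x\in L$ the left and right translations are the permutations of $L$ defined (maps written on the right) by $yL(x)=xy$ and $yR(x)=yx$. The multiplication group $\mathrm{Mlt}(L)$ is the permutation group on $L$ generated by all $L(x),R(x)$, $x\in L$. The inner mapping group $\mathrm{Mlt}_1(L)$ is the subgroup of $\mathrm{Mlt}(L)$ fixing $1$; its elements are the inner mappings. An A-loop is a loop in which every inner mapping is an automorphism of $L$. A loop $L$ is diassociative if for all $x,y\in L$ the subloop $\langle x,y\rangle$ generated by $x,y$ is a group. A Moufang loop is a loop satisfying $x(y(xz))=((xy)x)z$ for all $x,y,z$; every Moufang loop is diassociative and so has the inverse property ($x^{-1}(xy)=y$ and $(xy)y^{-1}=x$ for all $x,y$). The nucleus of an inverse property loop $L$ is $\mathrm{Nuc}(L)=\{x\in L:(xy)z=x(yz)\text{ for all }y,z\in L\}$, a normal subloop of $L$ all of whose elements associate with all pairs of elements of $L$; $L/\mathrm{Nuc}(L)$ is the quotient loop. ''Exponent three'' means that the cube of every element is the identity (the trivial loop is allowed). *)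

(* Defs.v *)
From HB Require Import structures.
From mathcomp Require Import all_boot.
From mathcomp Require Import boolp classical_sets.

Set Implicit Arguments.
Unset Strict Implicit.
Unset Printing Implicit Defensive.

Local Open Scope group_scope.
Local Open Scope classical_set_scope.

(* A umagmaType carries a choiceType structure; in the classical setting of
   boolp every type has one, so this does not restrict the class of loops. *)
HB.mixin Record UMagma_isLoop L of UMagma L := {
  ldiv_ex : forall a b : L, exists! x, a * x = b;
  rdiv_ex : forall a b : L, exists! y, y * a = b
}.

#[short(type="loopType")]
HB.structure Definition Loop := {L of UMagma L & UMagma_isLoop L}.

Section LoopTheory.
Variable L : loopType.
Implicit Types x y z : L.

Lemma loopIl x : injective (mul x).
Proof.
move=> y z e; have [w [_ u]] := ldiv_ex x (x * z).
by rewrite -(u y e) -(u z erefl).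
Qed.

Lemma loopIr x : injective (mul^~ x).
Proof.
move=> y z e; have [w [_ u]] := rdiv_ex x (z * x).
by rewrite -(u y e) -(u z erefl).
Qed.

Lemma loop_ldiv x y : exists z, x * z = y.
Proof. by have [z [e _]] := ldiv_ex x y; exists z. Qed.

Lemma loop_rdiv x y : exists z, z * x = y.
Proof. by have [z [e _]] := rdiv_ex x y; exists z. Qed.

End LoopTheory.

Definition ltrans (L : loopType) (x : L) : L -> L := fun y => x * y.
Definition rtrans (L : loopType) (x : L) : L -> L := fun y => y * x.

Definition perm_group (T : Type) (G : set (T -> T)) : Prop :=
  [/\ G `<=` [set f | bijective f],
      G id,
      forall f g, G f -> G g -> G (f \o g)
    & forall f g, G f -> cancel f g -> cancel g f -> G g].

Definition Mlt (L : loopType) : set (L -> L) :=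
  smallest (@perm_group L) (range (@ltrans L) `|` range (@rtrans L)).
Arguments Mlt : clear implicits.

Definition inner_mappings (L : loopType) : set (L -> L) :=
  Mlt L `&` [set f | f 1 = 1].
Arguments inner_mappings : clear implicits.

Definition loop_automorphism (L : loopType) (f : L -> L) : Prop :=
  bijective f /\ {morph f : x y / x * y}.

Definition A_loop (L : loopType) : Prop :=
  forall f, inner_mappings L f -> loop_automorphism f.

(* A subset that is itself a loop under the operation of L; since L need not be
   associative, closure under both divisions has to be required explicitly. *)
Definition is_subloop (L : loopType) (H : set L) : Prop :=
  [/\ H 1,
      forall a b, H a -> H b -> H (a * b),
      forall a x, H a -> H (a * x) -> H x
    & forall a y, H a -> H (y * a) -> H y].

Section Subloop.
Variables (L : loopType) (H : set L) (hH : is_subloop H).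

Definition subloop of is_subloop H : Type := set_type H.
Local Notation S := (subloop hH).

HB.instance Definition _ := Choice.copy S (set_type H).

Definition subloop_one : S :=
  exist _ 1 (let: And4 h _ _ _ := hH in mem_set h).

Definition subloop_mul (a b : S) : S :=
  exist _ (val a * val b)
    (let: And4 _ h _ _ := hH in
     mem_set (h _ _ (set_mem (valP a)) (set_mem (valP b)))).

Lemma subloop_mul1g : left_id subloop_one subloop_mul.
Proof. by move=> a; apply: val_inj; rewrite /= mul1g. Qed.

Lemma subloop_mulg1 : right_id subloop_one subloop_mul.
Proof. by move=> a; apply: val_inj; rewrite /= mulg1. Qed.

HB.instance Definition _ := hasMul.Build S subloop_mul.
HB.instance Definition _ := hasOne.Build S subloop_one.
HB.instance Definition _ :=
  BaseUMagma_isUMagma.Build S subloop_mul1g subloop_mulg1.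

Lemma subloop_ldiv (a b : S) : exists! x, a * x = b.
Proof.
case: hH => _ _ h _; have [x e] := loop_ldiv (val a) (val b).
have Hx : H x.
  apply: (h (val a)); first exact: set_mem (valP a).
  by rewrite e; exact: set_mem (valP b).
exists (exist _ x (mem_set Hx)); split; first exact: val_inj.
move=> y /(congr1 val) /= ey; apply: val_inj => /=.
by apply: (@loopIl _ (val a)); rewrite e.
Qed.

Lemma subloop_rdiv (a b : S) : exists! y, y * a = b.
Proof.
case: hH => _ _ _ h; have [x e] := loop_rdiv (val a) (val b).
have Hx : H x.
  apply: (h (val a)); first exact: set_mem (valP a).
  by rewrite e; exact: set_mem (valP b).
exists (exist _ x (mem_set Hx)); split; first exact: val_inj.
move=> y /(congr1 val) /= ey; apply: val_inj => /=.
by apply: (@loopIr _ (val a)); rewrite e.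
Qed.

HB.instance Definition _ := UMagma_isLoop.Build S subloop_ldiv subloop_rdiv.

End Subloop.

Definition gen_subloop (L : loopType) (A : set L) : set L :=
  smallest (@is_subloop L) A.

Lemma gen_subloopP (L : loopType) (A : set L) : is_subloop (gen_subloop A).
Proof.
split=> [M [[h1 _ _ _] _] //|a b ha hb M hM|a x ha hx M hM|a y ha hy M hM];
  have [[_ h2 h3 h4] _] := hM.
- exact: h2 (ha _ hM) (hb _ hM).
- exact: h3 (ha _ hM) (hx _ hM).
- exact: h4 (ha _ hM) (hy _ hM).
Qed.

(* A loop already has a two-sided identity. *)
Definition is_group (G : loopType) : Prop :=
  associative (@mul G) /\ forall x : G, exists y, y * x = 1 /\ x * y = 1.

Definition diassociative (L : loopType) : Prop :=
  forall x y : L, is_group (subloop (gen_subloopP [set x; y])).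

Definition lcoset (L : loopType) (x : L) (N : set L) : set L := mul x @` N.
Definition rcoset (L : loopType) (N : set L) (x : L) : set L := mul^~ x @` N.

Definition normal_subloop (L : loopType) (N : set L) : Prop :=
  is_subloop N /\
  forall x y, [/\ lcoset x N = rcoset N x,
                  lcoset x (lcoset y N) = lcoset (x * y) N
                & rcoset (rcoset N x) y = rcoset N (x * y)].

Section Quotient.
Variables (L : loopType) (N : set L) (hN : normal_subloop N).

(* The elements of L / N are the cosets xN as subsets of L, and the product
   below is the product of subsets; coset_mulE gives (xN)(yN) = (xy)N. *)
Definition quotient of normal_subloop N : Type :=
  set_type (range (fun x : L => lcoset x N)).
Local Notation Q := (quotient hN).

HB.instance Definition _ :=
  Choice.copy Q (set_type (range (fun x : L => lcoset x N))).

Definition coset_class (x : L) : Q :=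
  exist _ (lcoset x N) (mem_set (imageT _ x)).

Lemma coset_class_surj (A : Q) : exists x, A = coset_class x.
Proof.
by case: A => A hA; have [x _ e] := set_mem hA; exists x; apply: val_inj.
Qed.

Lemma coset_class_eq x y : coset_class x = coset_class y <-> lcoset y N x.
Proof.
have [[N1 NM Nl Nr] hn] := hN.
split=> [/(congr1 val) /= <-|[n Nn <-]].
  by exists 1 => //; rewrite mulg1.
apply: val_inj => /=; have [_ <- _] := hn y n.
congr (lcoset y _); apply/seteqP; split=> [_ [m Nm <-]|m Nm].
  exact: NM.
have [k e] := loop_ldiv n m; exists k => //.
by apply: (Nl n); rewrite ?e.
Qed.

Lemma coset_mulE (x y : L) :
  [set a * b | a in lcoset x N & b in lcoset y N] = lcoset (x * y) N.
Proof.
have [[N1 NM Nl Nr] hn] := hN.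
apply/seteqP; split=> [_ [a [n Nn <-] [b hb <-]]|_ [n Nn <-]].
- have hb' : lcoset (x * b) N = lcoset (x * y) N.
    have/(coset_class_eq (x * b) (x * y))/(congr1 val)// :
        lcoset (x * y) N (x * b).
    by have [_ <- _] := hn x y; exists b.
  rewrite -hb'.
  have [-> _ _] := hn (x * b) 1; have [e _ <-] := hn x b.
  by exists (x * n) => //; rewrite -e; exists n.
- have [_ e _] := hn x y.
  have : lcoset x (lcoset y N) (x * y * n) by rewrite e; exists n.
  case=> b hb <-; exists x; first by exists 1 => //; rewrite mulg1.
  by exists b.
Qed.

Lemma quotient_mul_subproof (A B : Q) :
  [set a * b | a in val A & b in val B]
    \in range (fun x : L => lcoset x N).
Proof.
have [x ->] := coset_class_surj A; have [y ->] := coset_class_surj B.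
by apply: mem_set; rewrite /= coset_mulE; exists (x * y).
Qed.

Definition quotient_mul (A B : Q) : Q :=
  exist _ [set a * b | a in val A & b in val B] (quotient_mul_subproof A B).

Definition quotient_one : Q := coset_class 1.

Lemma quotient_mulE x y :
  quotient_mul (coset_class x) (coset_class y) = coset_class (x * y).
Proof. by apply: val_inj; rewrite /= coset_mulE. Qed.

Lemma quotient_mul1g : left_id quotient_one quotient_mul.
Proof.
by move=> A; have [x ->] := coset_class_surj A; rewrite quotient_mulE mul1g.
Qed.

Lemma quotient_mulg1 : right_id quotient_one quotient_mul.
Proof.
by move=> A; have [x ->] := coset_class_surj A; rewrite quotient_mulE mulg1.
Qed.

HB.instance Definition _ := hasMul.Build Q quotient_mul.
HB.instance Definition _ := hasOne.Build Q quotient_one.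
HB.instance Definition _ :=
  BaseUMagma_isUMagma.Build Q quotient_mul1g quotient_mulg1.

Lemma quotient_ldiv (a b : Q) : exists! x, a * x = b.
Proof.
have [x ->] := coset_class_surj a; have [y ->] := coset_class_surj b.
have [z e] := loop_ldiv x y; exists (coset_class z); split.
  by rewrite -e -quotient_mulE.
move=> C; have [w ->] := coset_class_surj C.
rewrite -[_ * _]/(quotient_mul _ _) quotient_mulE => h.
have /coset_class_eq : coset_class y = coset_class (x * w) by [].
have [_ <- _] := hN.2 x w; rewrite -e => -[u hu /loopIl <-].
by apply/coset_class_eq.
Qed.

Lemma quotient_rdiv (a b : Q) : exists! y, y * a = b.
Proof.
have [x ->] := coset_class_surj a; have [y ->] := coset_class_surj b.
have [z e] := loop_rdiv x y; exists (coset_class z); split.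
  by rewrite -e -quotient_mulE.
move=> C; have [w ->] := coset_class_surj C.
rewrite -[_ * _]/(quotient_mul _ _) quotient_mulE => h.
have /coset_class_eq : coset_class y = coset_class (w * x) by [].
have [-> _ _] := hN.2 (w * x) 1; have [E _ <-] := hN.2 w x.
rewrite -e => -[u hu /loopIr <-].
by apply/coset_class_eq; rewrite E.
Qed.

HB.instance Definition _ := UMagma_isLoop.Build Q quotient_ldiv quotient_rdiv.

End Quotient.

Definition moufang (L : loopType) : Prop :=
  forall x y z : L, x * (y * (x * z)) = ((x * y) * x) * z.

(* This is the left nucleus; in an inverse property loop the left, middle and
   right nuclei coincide. *)
Definition nucleus (L : loopType) : set L :=
  [set x | forall y z, (x * y) * z = x * (y * z)].
Arguments nucleus : clear implicits.

Lemma nucleus_subloop (L : loopType) : is_subloop (nucleus L).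
Proof.
have NM (a b : L) : nucleus L a -> nucleus L b -> nucleus L (a * b).
  by move=> ha hb y z; rewrite !ha hb.
have NV (a b : L) : nucleus L a -> a * b = 1 -> nucleus L b /\ b * a = 1.
  move=> ha e; have K z : a * (b * z) = z by rewrite -ha e mul1g.
  split; last by apply: (@loopIl _ a); rewrite K mulg1.
  by move=> y z; apply: (@loopIl _ a); rewrite K -ha K.
split=> // [y z|a x ha hx|a y ha hy]; first by rewrite !mul1g.
- have [b e] := loop_ldiv a 1; have [hb e'] := NV _ _ ha e.
  by rewrite -[x]mul1g -e' hb; apply: NM.
- have [b e] := loop_ldiv a 1; have [hb e'] := NV _ _ ha e.
  suff -> : y = (y * a) * b by apply: NM.
  by apply: (@loopIr _ a); rewrite hy e' mulg1.
Qed.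

Section MoufangNucleus.
Variables (L : loopType) (hM : moufang L).

(* T x : y |-> x^-1 (y x) is a pseudo-automorphism of a Moufang loop, and
   pseudo-automorphisms preserve the nucleus. *)
Lemma nucleus_normal : normal_subloop (nucleus L).
Proof.
split; first exact: nucleus_subloop.
have [N1 NM Nl Nr] := nucleus_subloop L.
have [i xV] := choice (fun x : L => loop_ldiv x 1).
have flex (x y : L) : (x * y) * x = x * (y * x).
  by have := hM x y 1; rewrite !mulg1.
have K1 (x z : L) : i x * (x * z) = z.
  by apply: (@loopIl _ x); rewrite hM xV mul1g.
have Vx x : i x * x = 1 by rewrite -{2}[x]mulg1 K1.
have K2 (x z : L) : x * (i x * z) = z.
  by have [w <-] := loop_ldiv x z; rewrite K1.
have iK x : i (i x) = x by apply: (@loopIl _ (i x)); rewrite xV Vx.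
have iE (x y : L) : x * y = 1 -> y = i x.
  by move=> e; rewrite -[y](K1 x) e mulg1.
have K3 (z x : L) : (z * i x) * x = z.
  have H (y : L) : ((x * y) * x) * (i x * i y) = x.
    by rewrite -hM K2 xV mulg1.
  have [y' <-] := loop_ldiv (i x) z; rewrite -(iK y'); set y := i y'.
  have e : i x * (i y * i x) = i ((x * y) * x).
    by apply: iE; rewrite -hM K2 K2 xV.
  by rewrite flex e; apply: (@loopIl _ ((x * y) * x)); rewrite K2 H.
have K4 (z x : L) : (z * x) * i x = z by have := K3 z (i x); rewrite iK.
have iM (x y : L) : i (x * y) = i y * i x.
  have e : i (x * y) * x = i y by apply: (@loopIl _ (x * y)); rewrite K2 K4.
  by rewrite -e K4.
have A (x y w : L) : ((x * y) * x) * (i x * w) = x * (y * w).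
  by rewrite -hM K2.
have B (x w y : L) : (w * i x) * (x * (y * x)) = (w * y) * x.
  have := congr1 i (A (i x) (i y) (i w)).
  by rewrite !iM !iK.
have C (x y w : L) : (x * y) * (w * x) = (x * (y * w)) * x.
  have := B x ((x * y) * x) (i x * w).
  by rewrite K4 A -(flex x (i x * w)) K2.
pose T x y := i x * (y * x).
pose b x w := (i x * (w * i x)) * i x.
have TB x y w : T x y * b x w = b x (y * w).
  rewrite /T /b; have := B (i x) y w; rewrite iK => E.
  by rewrite C E.
have b_surj x v : exists w, b x w = v.
  exists ((x * (v * x)) * x); rewrite /b K4 K1 K4 //.
have T_surj x v : exists w, T x w = v.
  by exists ((x * v) * i x); rewrite /T K3 K1.
have TN x n : nucleus L n -> nucleus L (T x n).
  move=> hn.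
  have E y w : T x n * (T x y * b x w) = T x (n * y) * b x w.
    by rewrite !TB hn.
  have [w1 ew1] := b_surj x 1.
  have TM y : T x n * T x y = T x (n * y).
    by have := E y w1; rewrite ew1 !mulg1.
  move=> u v; have [y <-] := T_surj x u; have [w <-] := b_surj x v.
  by rewrite E TM.
have NV n : nucleus L n -> nucleus L (i n).
  by move=> hn; apply: (Nl n) => //; rewrite xV.
have Rn n x y : nucleus L n -> (x * y) * n = x * (y * n).
  move=> /NV hn; have := congr1 i (hn (i y) (i x)).
  by rewrite !iM !iK => ->.
move=> x y; split; apply/seteqP; split.
- move=> _ [n hn <-]; exists (x * (n * i x)).
    by have := TN (i x) n hn; rewrite /T iK.
  by rewrite /= flex K3.
- move=> _ [n hn <-]; exists (T x n); first exact: TN.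
  by rewrite /T K2.
- by move=> _ [_ [n hn <-] <-]; exists n => //; rewrite Rn.
- by move=> _ [n hn <-]; exists (y * n); [exists n|rewrite Rn].
- by move=> _ [_ [n hn <-] <-]; exists n => //; rewrite /= hn.
- by move=> _ [n hn <-]; exists (n * x); [exists n|rewrite /= hn].
Qed.

End MoufangNucleus.

(* x ^+ 3 is x * (x * x); in a Moufang loop it equals (x * x) * x. *)
Definition exponent_three (L : loopType) : Prop := forall x : L, x ^+ 3 = 1.

(* Main.v *)
(* In an inverse property loop consider the inner mappings
     linner x y = L(xy)^-1 L(x) L(y),   minner x y = L(x) R(y) L(x)^-1 R(y)^-1
   (maps composed from right to left).  If the loop is a diassociative A-loop,
   they are automorphisms fixing x and y, and
     linner x y u = minner x z u = x(yz)   for u = (xy)z.                  (1)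
   Conjugation by x being an automorphism, linner y x = minner y x o linner x y,
   whence minner y x is the inverse of minner x y.  Now fix x and write
   e_w = minner x w and p_w = linner x w.  Besides (1) one uses that e_w and e_z
   commute at wz, which comes from evaluating (1) at (wz)x and (wz)x^-1.  It
   follows first that linner x^-1 w is the inverse of p_w (lemma s_p), then
   p_{yu} u = p_y u (lemma p_mul), and finally that e_w is the inverse of p_w.
   With this L(x) L(y) L(x) = L(x(yx)), the Moufang law.

   In a Moufang loop, linner x y and T(x) = L(x)^-1 R(x) are pseudo-automorphisms
   with companions (yx)(xy)^-1 and x^-3, so they are automorphisms if and only if
   commutators and cubes lie in the nucleus.  They generate the inner mapping
   group, and in a Moufang A-loop diassociativity follows because an inner
   automorphism fixing x and y fixes the subloop <x, y> pointwise. *)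
Require Import Defs.
From mathcomp Require Import all_boot.
From mathcomp Require Import boolp classical_sets.

Set Implicit Arguments.
Unset Strict Implicit.
Unset Printing Implicit Defensive.

(** A right inverse, two-sided once the inverse property holds ([mulVx]). *)
Definition loop_inv (L : loopType) (x : L) : L := sval (cid (loop_ldiv x 1%g)).

(** * Inner mappings of inverse property loops *)

Section InnerMaps.
Variable L : loopType.
Implicit Types x y z u : L.
Local Open Scope group_scope.
Local Notation "x ^-1" := (loop_inv x) : group_scope.

Definition inverse_property : Prop :=
  forall x y, x^-1 * (x * y) = y /\ (y * x) * x^-1 = y.

Definition linner x y z : L := (x * y)^-1 * (x * (y * z)).
Definition rinner x y z : L := ((z * x) * y) * (x * y)^-1.
Definition minner x y z : L := x * ((x^-1 * (z * y^-1)) * y).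
Definition tinner x z : L := x^-1 * (z * x).

Lemma mulxV x : x * x^-1 = 1.
Proof. by rewrite /loop_inv; case: cid. Qed.

Hypothesis ipL : inverse_property.

Lemma mulKx x y : x^-1 * (x * y) = y. Proof. by have [] := ipL x y. Qed.
Lemma mulxK x y : (y * x) * x^-1 = y. Proof. by have [] := ipL x y. Qed.

Lemma mulVx x : x^-1 * x = 1.
Proof. by rewrite -{2}[x]mulg1 mulKx. Qed.

Lemma eq_invx x y : x * y = 1 -> y = x^-1.
Proof. by move=> e; rewrite -[y](mulKx x) e mulg1. Qed.

Lemma invxK x : x^-1^-1 = x.
Proof. by rewrite -(eq_invx (mulVx x)). Qed.

Lemma mulVKx x y : x * (x^-1 * y) = y.
Proof. by rewrite -{1}[x]invxK mulKx. Qed.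

Lemma mulxVK x y : (y * x^-1) * x = y.
Proof. by rewrite -{2}[x]invxK mulxK. Qed.

Lemma invxM x y : (x * y)^-1 = y^-1 * x^-1.
Proof.
have e : (x * y)^-1 * x = y^-1.
  by apply: (@loopIl _ (x * y)); rewrite mulVKx mulxK.
by rewrite -e mulxK.
Qed.

Lemma linnerE x y z : (x * y) * linner x y z = x * (y * z).
Proof. exact: mulVKx. Qed.

Lemma minnerE x y z : minner x y ((x * z) * y) = x * (z * y).
Proof. by rewrite /minner mulxK mulKx. Qed.

Lemma minner_fixl x y : minner x y x = x.
Proof. by rewrite /minner mulKx mulVx mulg1. Qed.

Lemma minner_fixr x y : minner x y y = y.
Proof. by rewrite /minner mulxV mulg1 mulVKx. Qed.

Section Morph.
Variable f : L -> L.
Hypothesis fM : {morph f : x y / x * y}.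

Lemma morph1 : f 1 = 1.
Proof. by apply: (@loopIl _ (f 1)); rewrite -fM !mulg1. Qed.

Lemma morphV x : f x^-1 = (f x)^-1.
Proof. by apply: eq_invx; rewrite -fM mulxV morph1. Qed.

Lemma morph_linner x y z : f (linner x y z) = linner (f x) (f y) (f z).
Proof. by rewrite /linner !(fM, morphV). Qed.

Lemma morph_minner x y z : f (minner x y z) = minner (f x) (f y) (f z).
Proof. by rewrite /minner !(fM, morphV). Qed.

End Morph.

Lemma Mlt_perm : perm_group (Mlt L).
Proof.
split=> [f h|M [[_ h _ _] _] //|f g hf hg M hM|f g hf fg gf M hM].
(* The bijections compete in the intersection defining [Mlt L], since the inverse property makes
   translations invertible. *)
- have hG : perm_group [set g : L -> L | bijective g].
    split=> //; first by exists id.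
    + by move=> f' g' /= hf hg; apply: bij_comp.
    + by move=> f' g' /= hf fg gf; exists f'.
  apply: (h _); split=> // g [[x _ <-]|[x _ <-]].
    exists (ltrans x^-1) => y; [exact: mulKx|exact: mulVKx].
  exists (rtrans x^-1) => y; [exact: mulxK|exact: mulxVK].
- by have [[_ _ h _] _] := hM; apply: h; [exact: hf|exact: hg].
- by have [[_ _ _ h] _] := hM; apply: h fg gf; exact: hf.
Qed.

Lemma Mlt_ltrans x : Mlt L (ltrans x).
Proof. by move=> M [_ h]; apply: h; left; exists x. Qed.

Lemma Mlt_rtrans x : Mlt L (rtrans x).
Proof. by move=> M [_ h]; apply: h; right; exists x. Qed.

Lemma linner_inner x y : inner_mappings L (linner x y).
Proof.
have [_ _ Mc _] := Mlt_perm; split.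
  apply: (Mc _ _ (Mlt_ltrans (x * y)^-1)).
  exact: (Mc _ _ (Mlt_ltrans x) (Mlt_ltrans y)).
by rewrite /= /linner mulg1 mulVx.
Qed.

Lemma rinner_inner x y : inner_mappings L (rinner x y).
Proof.
have [_ _ Mc _] := Mlt_perm; split.
  apply: (Mc _ _ (Mlt_rtrans (x * y)^-1)).
  exact: (Mc _ _ (Mlt_rtrans y) (Mlt_rtrans x)).
by rewrite /= /rinner mul1g mulxV.
Qed.

Lemma minner_inner x y : inner_mappings L (minner x y).
Proof.
have [_ _ Mc _] := Mlt_perm; split.
  apply: (Mc _ _ (Mlt_ltrans x)); apply: (Mc _ _ (Mlt_rtrans y)).
  exact: (Mc _ _ (Mlt_ltrans x^-1) (Mlt_rtrans y^-1)).
by rewrite /= /minner mul1g mulxVK mulxV.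
Qed.

Lemma tinner_inner x : inner_mappings L (tinner x).
Proof.
have [_ _ Mc _] := Mlt_perm; split.
  exact: (Mc _ _ (Mlt_ltrans x^-1) (Mlt_rtrans x)).
by rewrite /= /tinner mul1g mulVx.
Qed.

Hypothesis aL : A_loop L.

Lemma linnerM x y : {morph linner x y : u v / u * v}.
Proof. by have [_ fM] := aL (linner_inner x y). Qed.

Lemma rinnerM x y : {morph rinner x y : u v / u * v}.
Proof. by have [_ fM] := aL (rinner_inner x y). Qed.

Lemma minnerM x y : {morph minner x y : u v / u * v}.
Proof. by have [_ fM] := aL (minner_inner x y). Qed.

Lemma tinnerM x : {morph tinner x : u v / u * v}.
Proof. by have [_ fM] := aL (tinner_inner x). Qed.

(** * Flexible, right alternative A-loops are Moufang *)

Section Alternative.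
Hypothesis flex : forall x y, (x * y) * x = x * (y * x).
Hypothesis altr : forall x y, (x * y) * y = x * (y * y).

Lemma linner_fixl x y : linner x y x = x.
Proof. by rewrite /linner -flex mulKx. Qed.

Lemma linner_fixr x y : linner x y y = y.
Proof. by rewrite /linner -altr mulKx. Qed.

Lemma linner_assoc x y z : linner x y ((x * y) * z) = x * (y * z).
Proof. by rewrite linnerM linnerM linner_fixl linner_fixr linnerE. Qed.

Lemma linner_minner x y z : linner x y ((x * y) * z) = minner x z ((x * y) * z).
Proof. by rewrite linner_assoc minnerE. Qed.

Lemma minnerVl x z u : minner x z (minner x^-1 z u) = u.
Proof.
have [v ev] := loop_rdiv z u; have [y ey] := loop_ldiv x^-1 v.
rewrite -ev -ey minnerE minnerM (morphV (@minnerM _ _)) minner_fixl.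
by rewrite -{1}[y](mulVKx x) minnerE mulKx.
Qed.

Lemma minnerVr x z u : minner x z (minner x z^-1 u) = u.
Proof.
have [v ev] := loop_rdiv z^-1 u; have [y ey] := loop_ldiv x v.
rewrite -ev -ey minnerE -[x * (y * z^-1)](mulxK z).
rewrite minnerM minnerE (morphV (@minnerM _ _)) minner_fixr.
by rewrite mulxVK.
Qed.

Lemma minner_inj x z : injective (minner x z).
Proof. by have [/bij_inj] := aL (minner_inner x z). Qed.

(* Conjugation by [x] sends [x * y] to [y * x] and commutes with [linner x y]. *)
Lemma linnerC x y z : linner y x z = minner y x (linner x y z).
Proof.
have [u eu] := loop_rdiv x (x * z).
have uT : tinner x u = z by rewrite /tinner eu mulKx.
have TE v : tinner x (x * v) = v * x by rewrite /tinner flex mulKx.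
have Tc : tinner x (linner x y u) = linner x y z.
  by rewrite -uT /tinner !linnerM (morphV (@linnerM _ _)) linner_fixl.
have E : (y * u) * x = (y * x) * linner x y z.
  by rewrite -TE -linnerE tinnerM TE Tc.
apply: (@loopIl _ (y * x)); rewrite linnerE -eu -minnerE E minnerM.
by rewrite minnerM minner_fixl minner_fixr.
Qed.

(** Apply [linnerC] twice, with [x] and [y] exchanged, at a preimage of [u] under [linner x y]. *)
Lemma minnerK x y u : minner x y (minner y x u) = u.
Proof.
have -> : u = linner x y (y^-1 * (x^-1 * ((x * y) * u))).
  by rewrite /linner !mulVKx mulKx.
by rewrite -linnerC -linnerC.
Qed.

Lemma minner_invl x y u : minner x^-1 y u = minner y x u.
Proof. by apply: (@minner_inj x y); rewrite minnerVl minnerK. Qed.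

Lemma minner_invr x y u : minner x y^-1 u = minner y x u.
Proof. by apply: (@minner_inj x y); rewrite minnerVr minnerK. Qed.

(** With [u = ((z * x) * y) * x] and [y = linner z x w], both sides become [z * (x * (w * x))]. *)
Lemma minner_mull x z u : minner (z * x) x u = minner z x u.
Proof.
have [v ev] := loop_rdiv x u; have [y ey] := loop_ldiv (z * x) v.
pose w := x^-1 * (z^-1 * ((z * x) * y)).
have ew : linner z x w = y by rewrite /linner /w !mulVKx mulKx.
have ewx : linner z x (w * x) = y * x by rewrite linnerM ew linner_fixr.
rewrite -ev -ey minnerE -ewx linnerE -ew linnerE -flex.
by rewrite -minnerE.
Qed.

Lemma minner_mulr x z u : minner x (z * x) u = minner x z u.
Proof. by apply: (@minner_inj (z * x) x); rewrite minnerK minner_mull minnerK. Qed.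

Lemma linner_VK x w u : linner x^-1 w (linner x (x^-1 * w) u) = u.
Proof. by rewrite /linner !mulVKx !mulKx. Qed.

Lemma linner_KV x w u : linner x (x^-1 * w) (linner x^-1 w u) = u.
Proof. by rewrite /linner !mulVKx mulKx. Qed.

Lemma linner_invr x w u : linner x w^-1 u = linner x (x^-1 * w) (minner w x u).
Proof.
(* The automorphism [linner w x^-1] fixes [x] and [w], so it can be pulled out of [x * (w^-1 * _)],
   where its definition cancels. *)
have K v : linner x w^-1 (linner w x^-1 v) = v.
  have fM := @linnerM w x^-1.
  have fx : linner w x^-1 x = x by rewrite -{2 3}[x]invxK (morphV fM) linner_fixr.
  have E : x * (w^-1 * linner w x^-1 v) = (x * w^-1) * v.
    have -> : x * (w^-1 * linner w x^-1 v) = linner w x^-1 (x * (w^-1 * v)).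
      by rewrite !fM (morphV fM) fx linner_fixl.
    by rewrite /linner mulKx mulVKx invxM invxK.
  by rewrite {1}/linner E mulKx.
rewrite -[RHS]K; congr (linner x _ _).
by rewrite linnerC minner_invr linner_VK minnerK.
Qed.

(* [q w] and [s w] are the inverses of [p w] and [r w]. *)
Section Fixed.
Variable x : L.
Local Notation e w := (minner x w).
Local Notation p w := (linner x w).
Local Notation q w := (linner x^-1 (x * w)).
Local Notation r w := (linner x^-1 w).
Local Notation s w := (linner x (x^-1 * w)).

Let qK w u : p w (q w u) = u.
Proof. by have := linner_VK x^-1 w u; rewrite invxK. Qed.

Let pK w u : q w (p w u) = u.
Proof. by have := linner_KV x^-1 w u; rewrite invxK. Qed.

Let qE w z : q w (w * z) = e z^-1 (w * z).
Proof.
have := linner_minner x^-1 (x * w) z; rewrite mulKx => ->.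
by rewrite minner_invl minner_invr.
Qed.

Let sE w z : s w (w * z) = e z (w * z).
Proof. by have := linner_minner x (x^-1 * w) z; rewrite mulVKx. Qed.

Let px w : p w x = x. Proof. exact: linner_fixl. Qed.
Let ex w : e w x = x. Proof. exact: minner_fixl. Qed.
Let sx w : s w x = x. Proof. exact: linner_fixl. Qed.
Let sw w : s w w = w.
Proof. by rewrite -[RHS](linner_KV x w w) linner_fixr. Qed.

(* [s w] fixes [m], so [s w ((w * z) * m) = s w (w * z) * m]; evaluate both
   sides by [sE], writing [(w * z) * m] as [w * minner w^-1 m (z * m)]. *)
Let comm m w z : m = x \/ m = x^-1 ->
  minner w m (e z (w * z)) = e z (minner w m (w * z)).
Proof.
move=> hm; have fm f : {morph f : u v / u * v} -> f x = x -> f m = m.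
  by move=> fM fx; case: hm => ->; rewrite ?(morphV fM) fx.
have fx y : minner y m x = x.
  case: hm => ->; first exact: minner_fixr.
  by rewrite minner_invr minner_fixl.
have ez u : e (z * m) u = e z u.
  case: hm => ->; first exact: minner_mulr.
  by rewrite -minner_mulr mulxVK.
have em := fm _ (@minnerM x z) (ex z).
pose th := minner w^-1 m; have thM : {morph th : u v / u * v} := @minnerM _ _.
have thK u : th (minner w m u) = u by rewrite /th minner_invl minnerK.
have E : e z (w * z) * m = th (e z (minner w m (w * z))) * m.
  rewrite -{1}(fm _ (@linnerM _ _) (sx w)) -[e z (w * z)]sE -linnerM.
  have <- : w * th (z * m) = (w * z) * m.
    by rewrite -{1}[z](mulKx w) /th minnerE mulVKx.
  rewrite sE.
  have -> : w * th (z * m) = th (minner w m (w * z) * m).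
    by rewrite [RHS]thM thK (fm _ thM (fx _)) -{1}[z](mulKx w) /th minnerE mulVKx.
  by rewrite -{1}[x](fx w^-1) -(morph_minner thM) ez minnerM em thM
    (fm _ thM (fx _)).
by rewrite (loopIr E) /th minner_invl minnerK.
Qed.

Let commA w z : e w (e z (w * z)) = e z (e w (w * z)).
Proof. by have := comm w z (or_intror erefl); rewrite !minner_invr. Qed.

Let commB w z : e w^-1 (e z (w * z)) = e z (e w^-1 (w * z)).
Proof. by have := comm w z (or_introl erefl); rewrite !minner_invr. Qed.

Let pM w := @linnerM x w.
Let eM w := @minnerM x w.
Let sM w := @linnerM x (x^-1 * w).
Let qM w := @linnerM x^-1 (x * w).

Let rK w u : r w (s w u) = u. Proof. exact: linner_VK. Qed.
Let sK w u : s w (r w u) = u. Proof. exact: linner_KV. Qed.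

Let q_e y u : q y u = e (u^-1 * y) u.
Proof. by have := qE y (y^-1 * u); rewrite mulVKx invxM invxK. Qed.

(** Evaluate [q_e] at [u^-1] and invert: automorphisms commute with inversion. *)
Let q_e' y u : q y u = e (u * y) u.
Proof.
have := q_e y u^-1; rewrite invxK (morphV (qM y)) (morphV (eM _)).
by move/(congr1 (@loop_inv L)); rewrite !invxK.
Qed.

Let s_e y u : s y u = e (y^-1 * u) u.
Proof. by have := sE y (y^-1 * u); rewrite mulVKx. Qed.

Let s_e' y u : s y u = e (u * y)^-1 u.
Proof.
have := s_e y u^-1; rewrite (morphV (sM y)) (morphV (eM _)) -invxM.
by move/(congr1 (@loop_inv L)); rewrite !invxK.
Qed.

Let s_sq y u : s (s y u) (q u y) = y.
Proof.
set z := y^-1 * u; have qz : q u y = e z y by rewrite q_e.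
have eu : u = y * z by rewrite mulVKx.
have -> : s y u = e z y * z by rewrite s_e -/z eu eM minner_fixr.
have := sE (e z y * z) z^-1; rewrite mulxK qz => ->.
by rewrite minner_invr minnerK.
Qed.

Let p_s y u : p y u = p u (s y u).
Proof.
have rI v w : r (s v w) v = q w v by rewrite -{2}(s_sq v w) rK.
have rII v w : r w v = q (r v w) v by rewrite -rI sK.
have III : q (q u y) (s y u) = u by rewrite -[q u y]rI -rII rK.
have IV : p (q u y) u = s y u by rewrite -{2}III qK.
(* The automorphism [p u] fixes [x] and [u] and undoes [q u], so it carries [IV] to the claim. *)
by rewrite -IV (morph_linner (pM u)) px qK linner_fixr.
Qed.

Let q_q y u : q (q u y) y = s u (q u y).
Proof. by rewrite -{2}[y](qK u) p_s pK. Qed.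

(** By [q_e'] both sides are values of [e]; [commA] at [u = (u * y) * y^-1] then lets [e y] cancel
    [e y^-1]. *)
Let q_s y u : q (s u y) u = q y u.
Proof.
have E : u * s u y = e y (u * y) by rewrite -{1}[u]sw -sM sE.
rewrite q_e' E.
have := commA (u * y) y^-1; rewrite mulxK => C.
have -> : e (e y (u * y)) u = e y (e (u * y) (e y^-1 u)).
  by rewrite (morph_minner (eM y)) ex minnerVr.
by rewrite C minnerVr -q_e'.
Qed.

(** It is enough that [s v] inverts [q v], as [p v] does; [q_s] replaces [v] by [s w v] so that
    [s_sq] applies. *)
Let s_p y u : s y u = p y u.
Proof.
have E v w : s v (q v w) = w by rewrite -q_q -(q_s v w) q_q q_s s_sq.
by rewrite -{1}[u](pK y) E.
Qed.

Let p_e w z : p w (w * z) = e z (w * z).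
Proof. by rewrite -s_p sE. Qed.

Let p_eV w z : p z^-1 (w * z) = e w^-1 (w * z).
Proof.
have := p_e z^-1 w^-1; rewrite -invxM (morphV (pM _)) (morphV (eM _)).
by move/(congr1 (@loop_inv L)); rewrite !invxK.
Qed.

Let p_inv w u : p w^-1 u = p w (e w^-1 u).
Proof. by rewrite linner_invr s_p minner_invr. Qed.

Let p_mul y u : p (y * u) u = p y u.
Proof.
have [w ->] : exists w, y = w^-1 by exists y^-1; rewrite invxK.
set z := w^-1 * u; have -> : u = w * z by rewrite mulVKx.
have pe a v : p a (e a^-1 v) = e a^-1 (p a v).
  by rewrite (morph_minner (pM a)) px (morphV (pM a)) linner_fixr.
(* Both sides meet at [e z (p z^-1 (w * z))]. *)
rewrite p_inv pe p_e commB -p_eV -{1}[z]invxK p_inv pe.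
by rewrite invxK.
Qed.

(* Apply [p_mul] to the product [(v^-1 * (w' * v^-1)) * v = v^-1 * w']. *)
Lemma linner_minnerK w u : p w (e w u) = u.
Proof.
have q_eq y v : q y v = e y v.
  rewrite -[y]invxK; set w' := y^-1.
  have -> : q w'^-1 v = p (v^-1 * (w' * v^-1)) v.
    by rewrite -[RHS]s_p s_e' mulVKx q_e' invxM invxK.
  have <- : p (v^-1 * w') v = e w'^-1 v by rewrite -s_p s_e' mulVKx.
  by rewrite -[LHS]p_mul -flex mulxVK.
by rewrite -q_eq qK.
Qed.

End Fixed.

(** Regrouping [x * (y * (x * z))] to the left produces [linner y x], then [linner x (y * x)]; these
    are mutually inverse by [linner_minnerK] and [minner_mulr]. *)
Lemma alternative_A_loop_moufang : moufang L.
Proof.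
move=> x y z; rewrite -[y * (x * z)]linnerE -{1}(minnerK y x z).
by rewrite linner_minnerK -[LHS]linnerE -minner_mulr linner_minnerK flex.
Qed.

End Alternative.

End InnerMaps.

(** * Moufang loops: pseudo-automorphisms and the nucleus *)

Section Moufang.
Variable L : loopType.
Hypothesis mL : moufang L.
Implicit Types x y z u v : L.
Local Open Scope group_scope.
Local Notation "x ^-1" := (loop_inv x) : group_scope.

Lemma moufang_flex x y : (x * y) * x = x * (y * x).
Proof. by have := mL x y 1; rewrite !mulg1. Qed.

Lemma moufang_altl x y : (x * x) * y = x * (x * y).
Proof. by have := mL x 1 y; rewrite mul1g mulg1. Qed.

Lemma moufang_ip : inverse_property L.
Proof.
have K x y : x^-1 * (x * y) = y.
  by apply: (@loopIl _ x); rewrite mL mulxV mul1g.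
have KV x y : x * (x^-1 * y) = y by have [z <-] := loop_ldiv x y; rewrite K.
have VK x : x^-1^-1 = x by rewrite -[LHS](KV x) mulxV mulg1.
have eqV x y : x * y = 1 -> y = x^-1 by move=> e; rewrite -[y](K x) e mulg1.
have KR x y : (y * x^-1) * x = y.
  (* With [y = x^-1 * w^-1], the inverse of [y * x^-1] is [(x * w) * x]; multiplying by it on the
     left leaves only left cancellations. *)
  have [z <-] := loop_ldiv x^-1 y; rewrite -[z]VK; set w := z^-1.
  have E : (x^-1 * w^-1) * x^-1 = ((x * w) * x)^-1.
    by apply: eqV; rewrite (moufang_flex x^-1) -mL !KV mulxV.
  apply: (@loopIl _ ((x * w) * x)).
  by rewrite E KV -mL KV mulxV mulg1.
by move=> x y; split=> [|]; [exact: K|rewrite -{1}[x]VK KR].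
Qed.

Let ipL := moufang_ip.
Local Notation mulKx := (mulKx ipL).
Local Notation mulxK := (mulxK ipL).
Local Notation mulVKx := (mulVKx ipL).
Local Notation mulxVK := (mulxVK ipL).
Local Notation invxK := (invxK ipL).
Local Notation invxM := (invxM ipL).
Local Notation mulVx := (mulVx ipL).
Local Notation linnerE := (linnerE ipL).

Lemma moufang_altr x y : (x * y) * y = x * (y * y).
Proof.
have := moufang_altl y^-1 x^-1; rewrite -!invxM => /(congr1 (@loop_inv L)).
by rewrite !invxK.
Qed.

Lemma moufangl x y z : ((x * y) * x) * (x^-1 * z) = x * (y * z).
Proof. by rewrite -mL mulVKx. Qed.

(** The mirror image of [moufangl] under inversion. *)
Lemma moufangr x y z : (z * x^-1) * (x * (y * x)) = (z * y) * x.
Proof.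
have /(congr1 (@loop_inv L)) := moufangl x^-1 y^-1 z^-1.
by rewrite !(invxM, invxK).
Qed.

Lemma moufangm x y z : (x * y) * (z * x) = (x * (y * z)) * x.
Proof.
have := moufangr x (x^-1 * z) ((x * y) * x).
by rewrite mulxK moufangl -(moufang_flex x (x^-1 * z)) mulVKx.
Qed.

(** Here [f] is a pseudo-automorphism with companion [k = g 1], so it is multiplicative exactly when
    [k] associates as a right factor; inversion turns this into [k^-1] lying in the left nucleus. *)
Lemma pseudo_automorphism_morph (f g : L -> L) :
    (forall z, exists u, f u = z) -> f 1 = 1 ->
    (forall u v, f u * g v = g (u * v)) ->
  {morph f : u v / u * v} <-> nucleus L (g 1)^-1.
Proof.
move=> f_surj f1 fg; set k := g 1.
have fk u v : f u * (f v * k) = f (u * v) * k.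
  by rewrite !fg !mulg1.
have kP : nucleus L k^-1 <-> forall u v, (u * v) * k = u * (v * k).
  split=> h u v.
    have := congr1 (@loop_inv L) (h v^-1 u^-1).
    by rewrite !(invxM, invxK).
  have := congr1 (@loop_inv L) (h v^-1 u^-1).
  by rewrite !(invxM, invxK).
split=> [fM|/kP h u v].
  apply/kP => u v; have [u' <-] := f_surj u; have [v' <-] := f_surj v.
  by rewrite fk fM.
by apply: (@loopIr _ k); rewrite -fk h.
Qed.

Lemma linner_surj x y z : exists u, linner x y u = z.
Proof.
exists (y^-1 * (x^-1 * ((x * y) * z))).
by rewrite /linner !mulVKx mulKx.
Qed.

Lemma tinner_surj x z : exists u, tinner x u = z.
Proof. by exists ((x * z) * x^-1); rewrite /tinner mulxVK mulKx. Qed.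

(* [linner x y] is the first component of the autotopism that is the quotient
   of the Moufang autotopisms [u * v -> x(y(uv)y)x] and [u * v -> (xy)(uv)(xy)]. *)
Lemma linner_morph x y :
  {morph linner x y : u v / u * v} <-> nucleus L ((x * y) * (y * x)^-1).
Proof.
pose g v := ((v * y) * x) * (x * y)^-1.
have E u v : ((x * y) * (linner x y u * g v)) * (x * y) =
             (x * ((y * (u * v)) * y)) * x.
  by rewrite -moufangm mulxVK linnerE // moufangm moufangm.
have c1 : linner x y 1 = 1 by rewrite /linner mulg1 mulVx.
have fg u v : linner x y u * g v = g (u * v).
  apply: (@loopIl _ (x * y)); apply: (@loopIr _ (x * y)).
  by rewrite E -[u * v]mul1g -E c1 !mul1g.
have := pseudo_automorphism_morph (linner_surj x y) c1 fg.
by rewrite /g mul1g (invxM (y * x)) invxK.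
Qed.

(** [moufangm] and [moufangr] at [x^-1] give an autotopism whose companion [g 1] has inverse
    [x * (x * x)]. *)
Lemma tinner_morph x : {morph tinner x : u v / u * v} <-> nucleus L (x * (x * x)).
Proof.
pose g v := (x^-1 * (v * x^-1)) * x^-1.
have fg u v : tinner x u * g v = g (u * v).
  by rewrite moufangm; have := moufangr x^-1 v u; rewrite invxK => ->.
have T1 : tinner x 1 = 1 by rewrite /tinner mul1g mulVx.
have := pseudo_automorphism_morph (tinner_surj x) T1 fg.
by rewrite /g mul1g !invxM !invxK.
Qed.

Local Notation Q := (quotient (nucleus_normal mL)).

Lemma quotient_commutativeP :
  commutative (@mul Q) <-> forall x y, {morph linner x y : u v / u * v}.
Proof.
pose qm := @quotient_mulE _ _ (nucleus_normal mL).
split=> h.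
  move=> x y; apply/linner_morph.
  (* At inverses, the left quotient of the two coset representatives is exactly
     [(x * y) * (y * x)^-1]. *)
  have := h (coset_class _ x^-1) (coset_class _ y^-1).
  rewrite -[_ * _ in LHS]/(quotient_mul _ _) -[_ * _ in RHS]/(quotient_mul _ _).
  rewrite !qm => /coset_class_eq [n Nn e].
  by rewrite (_ : _ * _ = n) // -(mulKx (y^-1 * x^-1) n) e !invxM !invxK.
move=> A B.
have [x ->] := coset_class_surj A; have [y ->] := coset_class_surj B.
rewrite -[_ * _ in LHS]/(quotient_mul _ _) -[_ * _ in RHS]/(quotient_mul _ _).
rewrite !qm; apply/coset_class_eq.
exists ((y * x)^-1 * (x * y)); last by rewrite /= mulVKx.
by have /linner_morph := h x^-1 y^-1; rewrite (invxM y^-1) !invxK -invxM.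
Qed.


Lemma quotient_exponent_threeP :
  exponent_three Q <-> forall x, {morph tinner x : u v / u * v}.
Proof.
pose qm := @quotient_mulE _ _ (nucleus_normal mL).
have q3 x : (coset_class (nucleus_normal mL) x : Q) ^+ 3 =
             coset_class (nucleus_normal mL) (x * (x * x)).
  by rewrite -!qm.
split=> h.
  move=> x; apply/tinner_morph.
  have := h (coset_class _ x); rewrite q3 => /coset_class_eq [n Nn <-].
  by rewrite mul1g.
move=> A; have [x ->] := coset_class_surj A.
rewrite q3; apply/coset_class_eq; exists (x * (x * x)); last exact: mul1g.
exact/tinner_morph.
Qed.


End Moufang.

(** * Generators of the inner mapping group, and diassociativity *)

Section Characterization.
Variable L : loopType.
Implicit Types a b c k x y z u v : L.
Local Open Scope group_scope.
Local Open Scope classical_set_scope.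
Local Notation "x ^-1" := (loop_inv x) : group_scope.

(* Every [f] in [Mlt L] factors as the left translation by [f 1] followed by an
   inner mapping, which is a product of maps [linner x y] and [tinner x]. *)
Lemma A_loop_of_generators : inverse_property L ->
    (forall x y, {morph linner x y : u v / u * v}) ->
    (forall x, {morph tinner x : u v / u * v}) ->
  A_loop L.
Proof.
move=> ipL lM tM.
pose G := [set f : L -> L | exists2 g, loop_automorphism g &
                            exists a, forall u, f u = a * g u].
have autC g h : loop_automorphism g -> loop_automorphism h ->
    loop_automorphism (g \o h).
  by move=> [bg gM] [bh hM]; split=> [|u v /=]; [exact: bij_comp|rewrite hM gM].
have lA x y : loop_automorphism (linner x y).
  split=> //; exists (fun z => y^-1 * (x^-1 * ((x * y) * z))) => z.
    by rewrite linnerE // !mulKx.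
  by rewrite /linner !mulVKx ?mulKx.
have tA x : loop_automorphism (tinner x).
  split=> //; exists (fun z => (x * z) * x^-1) => z.
    by rewrite /tinner mulVKx ?mulxK.
  by rewrite /tinner mulxVK ?mulKx.
have GG : perm_group G.
  split.
  - move=> f [g [[h gh hg] _] [a E]]; exists (fun v => h (a^-1 * v)) => u.
      by rewrite E mulKx.
    by rewrite E hg mulVKx.
  - by exists id; [split=> //; exists id|exists 1 => u; rewrite mul1g].
  - move=> f f' [g gA [a E]] [g' gA' [a' E']].
    (* Regrouping [a * (g a' * g (g' u))] to the left costs [linner a (g a')]. *)
    exists (linner a (g a') \o (g \o g')); first exact/autC/autC.
    by exists (a * g a') => u; rewrite /= E E' gA.2 linnerE.
  - move=> f f' [g [[h gh hg] gM] [a E]] ff' f'f.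
    have hM : {morph h : u v / u * v}.
      by move=> u v; apply: (can_inj gh); rewrite gM !hg.
    exists h; first by split=> //; exists g.
    exists (h a^-1) => u; rewrite -hM; apply: (can_inj gh); rewrite hg.
    by apply: (@loopIl _ a); rewrite mulVKx // -E f'f.
have GM : Mlt L `<=` G.
  move=> f; apply; split=> // _ [[x _ <-]|[x _ <-]].
    by exists id; [split=> //; exists id|exists x].
  by exists (tinner x) => //; exists x => u; rewrite /tinner mulVKx.
move=> f [/GM [g [gb gM] [a E]] f1].
suff -> : f = g by [].
have a1 : a = 1 by move: f1; rewrite /= E (morph1 gM) mulg1.
by apply/funext => u; rewrite E a1 mul1g.
Qed.

Lemma moufang_A_loop_diassociative :
  moufang L -> A_loop L -> diassociative L.
Proof.
move=> mL aL x y.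
have ipL := moufang_ip mL.
have flex := moufang_flex mL; have altr := moufang_altr mL.
set H := gen_subloop [set x; y].
have Hx : H x by move=> M [_ h]; apply: h; left.
have Hy : H y by move=> M [_ h]; apply: h; right.
have fixH (f : L -> L) : {morph f : u v / u * v} -> f x = x -> f y = y ->
    forall u, H u -> f u = u.
  move=> fM fx fy u hu; have := hu [set v | f v = v]; apply.
  split=> [|v [->|->] //].
  split=> /= [|a b ea eb|a b ea|a b ea]; rewrite ?fM ?(morph1 fM) ?ea ?eb //.
    exact: loopIl.
  exact: loopIr.
have lM := linnerM ipL aL; have rM := rinnerM ipL aL; have mM := minnerM ipL aL.
have lP a b c : linner a b c = c <-> (a * b) * c = a * (b * c).
  by split=> [e|e]; [rewrite -(linnerE ipL) e|rewrite /linner -e mulKx].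
have rP a b c : rinner a b c = c <-> (c * a) * b = c * (a * b).
  by split=> [e|e]; [rewrite -{2}e /rinner mulxVK|rewrite /rinner e mulxK].
have mP a b c : minner a b c = c <-> (a * c) * b = a * (c * b).
  have E : (a * minner a b c) * b = a * (c * b).
    by rewrite -(minnerE ipL) !mM minner_fixl // minner_fixr.
  split=> [e|e]; first by rewrite -{1}e E.
  by apply: (@loopIl _ a); apply: (@loopIr _ b); rewrite E e.
(* Automorphisms fixing [x] and [y] fix [H], so associativity spreads from the generators to [H] in
   the middle factor, then the left one, then the right one. *)
have mxy (h : L) : H h -> (x * h) * y = x * (h * y).
  move=> Hh; apply/mP; apply: fixH Hh => //; first exact: minner_fixl.
  exact: minner_fixr.
have myx (h : L) : H h -> (y * h) * x = y * (h * x).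
  move=> Hh; apply/mP; apply: fixH Hh => //; first exact: minner_fixr.
  exact: minner_fixl.
have rx (h k : L) : H h -> H k -> (k * h) * x = k * (h * x).
  by move=> Hh Hk; apply/rP; apply: fixH Hk => //; apply/rP => //; exact: myx.
have ry (h k : L) : H h -> H k -> (k * h) * y = k * (h * y).
  by move=> Hh Hk; apply/rP; apply: fixH Hk => //; apply/rP => //; exact: mxy.
have assoc a b c : H a -> H b -> H c -> (a * b) * c = a * (b * c).
  move=> Ha Hb Hc; apply/lP; apply: fixH Hc => //; apply/lP.
    exact: rx.
  exact: ry.
have sA : associative (@mul (subloop (gen_subloopP [set x; y]))).
  move=> a b c; apply: val_inj; symmetry.
  by apply: assoc; exact: set_mem (valP _).
split=> // a.
have [b ba] := loop_rdiv a 1; have [c ac] := loop_ldiv a 1.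
by exists b; split=> //; rewrite -[b]mulg1 -ac (sA b) ba mul1g.
Qed.

Lemma diassociativeP : diassociative L ->
  forall x y a b c, gen_subloop [set x; y] a -> gen_subloop [set x; y] b ->
    gen_subloop [set x; y] c -> (a * b) * c = a * (b * c).
Proof.
move=> dL x y a b c ha hb hc; have [h _] := dL x y.
by have /(congr1 val) := h (exist _ a (mem_set ha)) (exist _ b (mem_set hb))
     (exist _ c (mem_set hc)).
Qed.

Lemma diassociative_ip : diassociative L ->
  [/\ inverse_property L, forall x y, (x * y) * x = x * (y * x) &
      forall x y, (x * y) * y = x * (y * y)].
Proof.
move=> dL; pose H x y := gen_subloop [set x; y].
have Hx x y : H x y x by move=> M [_ h]; apply: h; left.
have Hy x y : H x y y by move=> M [_ h]; apply: h; right.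
have HV x y : H x y x^-1.
  have [h1 _ hl _] := gen_subloopP [set x; y].
  by apply: (hl x); [exact: Hx|rewrite mulxV].
have Vx x : x^-1 * x = 1.
  apply: (@loopIl _ x).
  by rewrite -(diassociativeP dL (Hx x x) (HV x x) (Hx x x)) mulxV mul1g mulg1.
split=> x y; last 2 first.
- exact: (diassociativeP dL (Hx x y) (Hy x y) (Hx x y)).
- exact: (diassociativeP dL (Hx x y) (Hy x y) (Hy x y)).
split.
  by rewrite -(diassociativeP dL (HV x y) (Hx x y) (Hy x y)) Vx mul1g.
by rewrite (diassociativeP dL (Hy x y) (Hx x y) (HV x y)) mulxV mulg1.
Qed.

End Characterization.

Theorem corollary2 (L : loopType) :
  (diassociative L /\ A_loop L) <->
  (exists hM : moufang L,
     commutative (@mul (quotient (nucleus_normal hM))) /\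
     exponent_three (quotient (nucleus_normal hM))).
Proof.
split=> [[dL aL]|[mL [/quotient_commutativeP lM /quotient_exponent_threeP tM]]].
  have [ipL flex altr] := diassociative_ip dL.
  exists (alternative_A_loop_moufang ipL aL flex altr); split.
    exact/quotient_commutativeP/linnerM.
  exact/quotient_exponent_threeP/tinnerM.
have aL : A_loop L by apply: A_loop_of_generators => //; exact: moufang_ip.
by split=> //; apply: moufang_A_loop_diassociative.
Qed.
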